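(* Let $(M,g,S)$ be a four-dimensional Riemannian manifold with a skew-circulant structure $S$ (as defined in the context) whose curvature tensor satisfies $R(Sx,Sy,Sz,Su)=R(x,y,z,u)$ for all $x,y,z,u$. Then $(M,g,S)$ is almost Einstein, i.e. there exist smooth functions $\alpha$ and $\beta$ on $M$ such that $$\rho(x,y)=\alpha\, g(x,y)+\beta\,\tilde g(x,y)$$ for all $x,y$, where $\rho$ is the Ricci tensor of $g$.
   Context: Throughout, $(M,g,S)$ denotes a $4$-dimensional differentiable manifold $M$ with a Riemannian metric $g$ and a tensor $S$ of type $(1,1)$ whose components with respect to the local basis $\{e_1,e_2,e_3,e_4\}$ form the right skew-circulant matrix $$(S_i^j)=\begin{pmatrix}0&1&0&0\\ 0&0&1&0\\ 0&0&0&1\\ -1&0&0&0\end{pmatrix},\qquad Se_i=S_i^j e_j,$$ so $S^4=-\mathrm{id}$. $S$ is assumed to be an isometry: $g(Sx,Sy)=g(x,y)$. Consequently the components $g_{ij}=g(e_i,e_j)$ are $$(g_{ij})=\begin{pmatrix} A & B & 0 & -B \\ B & A & B & 0 \\ 0 & B & A & B \\ -B & 0 & B & A \end{pmatrix}$$ with smooth functions $A,B$, where it is supposed that $A>\sqrt2\,B>0$ (so $g$ is positive definite). Here $x,y,z,u$ are arbitrary smooth vector fields on $M$ or vectors in a tangent space $T_pM$. The associated metric $\tilde g$ (indefinite) is $\tilde g(x,y)=g(x,Sy)+g(Sx,y)$. $\nabla$ is the Levi-Civita connection of $g$, $R(x,y)z=\nabla_x\nabla_y z-\nabla_y\nabla_x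 z-\nabla_{[x,y]}z$, and $R(x,y,z,u)=g(R(x,y)z,u)$. The Ricci tensor is $\rho(y,z)=g^{ij}R(e_i,y,z,e_j)$, where $(g^{ij})$ is the inverse matrix of $(g_{ij})$ and summation over repeated indices is understood. *)

(* Defs.v *)
From HB Require Import structures.
From mathcomp Require Export all_boot all_order all_algebra.
From mathcomp Require Export all_classical all_reals all_analysis.
Export Order.TTheory GRing.Theory Num.Theory.
Export numFieldNormedType.Exports.

Set Implicit Arguments.
Unset Strict Implicit.
Unset Printing Implicit Defensive.

Local Open Scope classical_set_scope.
Local Open Scope ring_scope.

(* Meant for U open: the partial derivatives at points of U then only depend
   on the restriction of f to U. *)
Fixpoint Ck (R : realType) (n k : nat) (U : set 'rV[R]_n)
    (f : 'rV[R]_n -> R) : Prop :=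
  (forall x, U x -> {for x, continuous f}) /\
  if k is k'.+1 then
    forall i : 'I_n, (forall x, U x -> derivable f x (delta_mx 0 i)) /\
                     Ck k' U (fun x => 'D_(delta_mx 0 i) f x)
  else True.

Definition Cinfty (R : realType) (n : nat) (U : set 'rV[R]_n)
    (f : 'rV[R]_n -> R) : Prop := forall k, Ck k U f.

(* [chart_map] and [chart_inv] are total functions, meaningful only on
   [chart_dom] and [chart_img] respectively. *)
Record chart (R : realType) (n : nat) (M : topologicalType) := Chart {
  chart_dom : set M;
  chart_img : set 'rV[R]_n;
  chart_map : M -> 'rV[R]_n;
  chart_inv : 'rV[R]_n -> M;
  chart_dom_open : open chart_dom;
  chart_img_open : open chart_img;
  chart_mapP : forall p, chart_dom p -> chart_img (chart_map p);
  chart_invP : forall x, chart_img x -> chart_dom (chart_inv x);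
  chart_mapK : forall p, chart_dom p -> chart_inv (chart_map p) = p;
  chart_invK : forall x, chart_img x -> chart_map (chart_inv x) = x;
  chart_map_continuous :
    forall p, chart_dom p -> {for p, continuous chart_map};
  chart_inv_continuous :
    forall x, chart_img x -> {for x, continuous chart_inv} }.

Record manifold (R : realType) (n : nat) := Manifold {
  mcarrier :> topologicalType;
  mhausdorff : hausdorff_space mcarrier;
  msecond_countable : @second_countable mcarrier;
  atlas : set (chart R n mcarrier);
  atlas_cover : forall p, exists2 c, atlas c & chart_dom c p;
  atlas_compatible : forall c c', atlas c -> atlas c' -> forall j : 'I_n,
    Cinfty (chart_img c `&` chart_inv c @^-1` chart_dom c')
           (fun x => chart_map c' (chart_inv c x) 0 j) }.

Section TangentSpace.
Variables (R : realType) (n : nat) (M : manifold R n).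

Definition smooth_on (U : set M) (f : M -> R) : Prop :=
  forall c, atlas c ->
    Cinfty (chart_img c `&` chart_inv c @^-1` U) (f \o chart_inv c).

Definition smooth_at (p : M) (f : M -> R) : Prop :=
  exists U : set M, [/\ open U, U p & smooth_on U f].

(* Tangent vectors at p are the derivations of the algebra of germs at p of
   smooth functions.  A germ is given by any function M -> R smooth near p,
   and the junk value of a derivation on the other functions is set to 0, so
   that equality of tangent vectors is Leibniz equality. *)
Definition is_derivation (p : M) (v : (M -> R) -> R^o) : Prop :=
  [/\ forall f, ~ smooth_at p f -> v f = 0,
      forall f h, smooth_at p f -> smooth_at p h ->
        (\forall q \near p, f q = h q) -> v f = v h,
      forall (a : R) f h, smooth_at p f -> smooth_at p h ->
        v (fun q => a * f q + h q) = a * v f + v h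
    & forall f h, smooth_at p f -> smooth_at p h ->
        v (fun q => f q * h q) = v f * h p + f p * v h].

Definition derivation (p : M) : {pred ((M -> R) -> R^o)} :=
  [pred v | `[< is_derivation p v >]].

Lemma derivation_submod p : submod_closed (derivation p).
Proof.
split.
  apply/asboolP; split=> // [a f h _ _|f h _ _].
    by rewrite /= mulr0 addr0.
  by rewrite /= mul0r mulr0 addr0.
move=> a u v /asboolP[u1 u2 u3 u4] /asboolP[v1 v2 v3 v4].
have E f : (a *: u + v) f = a * u f + v f by [].
apply/asboolP; split=> [f nf|f h sf sh fh|b f h sf sh|f h sf sh]; rewrite !E.
- by rewrite u1 // v1 // mulr0 addr0.
- by rewrite (u2 f h) // (v2 f h).
- by rewrite u3 // v3 // !mulrDr addrACA; congr (_ + _ + _); rewrite mulrCA.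
- by rewrite u4 // v4 // !mulrDr !mulrDl addrACA !mulrA (mulrC a (f p)).
Qed.

HB.instance Definition _ p :=
  GRing.isSubmodClosed.Build R ((M -> R) -> R^o) (derivation p)
    (derivation_submod p).

Record tangent (p : M) := TangentVector {
  tangent_fun :> (M -> R) -> R^o;
  tangentP : tangent_fun \in derivation p }.

HB.instance Definition _ p := [isSub for @tangent_fun p].
HB.instance Definition _ p := [Choice of tangent p by <:].
HB.instance Definition _ p := [SubChoice_isSubLmodule of tangent p by <:].

(* Not necessarily smooth sections of the tangent bundle.  A vector field
   defined on an open set U is represented by any section whose restriction
   to U is that field. *)
Definition section := forall p : M, tangent p.

Definition smooth_field (U : set M) (X : section) : Prop :=
  forall p, U p -> forall f, smooth_at p f -> smooth_at p (fun q => X q f).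

(* [insubd 0] gives the junk value 0 at points where X or Y is not smooth; near
   points where both are smooth, the function below is a derivation. *)
Definition lie_bracket (X Y : section) : section := fun p =>
  insubd (0 : tangent p) (fun f : M -> R =>
    if `[< smooth_at p f >]
    then X p (fun q => Y q f) - Y p (fun q => X q f) else 0).

Definition local_frame (U : set M) (e : 'I_n -> section) : Prop :=
  (forall i, smooth_field U (e i)) /\
  forall p, U p -> forall v : tangent p,
    exists! c : 'rV[R]_n, v = \sum_i c 0 i *: e i p.

End TangentSpace.

Section Riemannian.
Variables (R : realType) (n : nat) (M : manifold R n).

Record riemannian_metric := RiemannianMetric {
  metric :> forall p : M, tangent p -> tangent p -> R;
  metric_linear : forall p (a : R) (x y z : tangent p),
    metric (a *: x + y) z = a * metric x z + metric y z;
  metric_sym : forall p (x y : tangent p), metric x y = metric y x;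
  metric_pos : forall p (x : tangent p), x != 0 -> 0 < metric x x;
  metric_smooth : forall (U : set M) (X Y : section M), open U ->
    smooth_field U X -> smooth_field U Y ->
    smooth_on U (fun p => metric (X p) (Y p)) }.

Definition gram (g : riemannian_metric) (e : 'I_n -> section M) (p : M) :
    'M[R]_n := \matrix_(i, j) g p (e i p) (e j p).

(* An affine connection is an operation on the smooth vector fields of every
   open set U that commutes with restriction to smaller open sets
   ([connection_local]). *)
Record affine_connection (D : section M -> section M -> section M) : Prop := {
  connection_smooth : forall (U : set M) X Y, open U ->
    smooth_field U X -> smooth_field U Y -> smooth_field U (D X Y);
  connection_local : forall (U : set M) X X' Y Y', open U ->
    smooth_field U X -> smooth_field U X' ->
    smooth_field U Y -> smooth_field U Y' ->
    (forall p, U p -> X p = X' p) -> (forall p, U p -> Y p = Y' p) ->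
    forall p, U p -> D X Y p = D X' Y' p;
  connection_addl : forall (U : set M) X X' Y, open U ->
    smooth_field U X -> smooth_field U X' -> smooth_field U Y ->
    forall p, U p -> D (fun q => X q + X' q) Y p = D X Y p + D X' Y p;
  connection_scalel : forall (U : set M) f X Y, open U ->
    smooth_on U f -> smooth_field U X -> smooth_field U Y ->
    forall p, U p -> D (fun q => f q *: X q) Y p = f p *: D X Y p;
  connection_addr : forall (U : set M) X Y Y', open U ->
    smooth_field U X -> smooth_field U Y -> smooth_field U Y' ->
    forall p, U p -> D X (fun q => Y q + Y' q) p = D X Y p + D X Y' p;
  connection_leibniz : forall (U : set M) f X Y, open U ->
    smooth_on U f -> smooth_field U X -> smooth_field U Y ->
    forall p, U p ->
      D X (fun q => f q *: Y q) p = (X p f : R) *: Y p + f p *: D X Y p }.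

Record levi_civita (g : riemannian_metric)
    (D : section M -> section M -> section M) : Prop := {
  levi_civita_connection : affine_connection D;
  levi_civita_torsion_free : forall (U : set M) X Y, open U ->
    smooth_field U X -> smooth_field U Y ->
    forall p, U p -> D X Y p - D Y X p = lie_bracket X Y p;
  levi_civita_metric : forall (U : set M) X Y Z, open U ->
    smooth_field U X -> smooth_field U Y -> smooth_field U Z ->
    forall p, U p ->
      X p (fun q => g q (Y q) (Z q)) = g p (D X Y p) (Z p) + g p (Y p) (D X Z p) }.

Definition curvature (D : section M -> section M -> section M)
    (X Y Z : section M) : section M :=
  fun p => D X (D Y Z) p - D Y (D X Z) p - D (lie_bracket X Y) Z p.

Definition curvature4 (g : riemannian_metric)
    (D : section M -> section M -> section M) (X Y Z V : section M) (p : M) : R :=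
  g p (curvature D X Y Z p) (V p).

(* The value does not depend on the local frame e around p. *)
Definition ricci (g : riemannian_metric)
    (D : section M -> section M -> section M) (e : 'I_n -> section M)
    (Y Z : section M) (p : M) : R :=
  \sum_i \sum_j invmx (gram g e p) i j * curvature4 g D (e i) Y Z (e j) p.

End Riemannian.

Definition skew_circulant_mx (R : realType) : 'M[R]_4 :=
  \matrix_(i, j) if j == i.+1 :> nat then 1
                 else if (i == 3 :> nat) && (j == 0 :> nat) then -1 else 0.

Section SkewCirculant.
Variables (R : realType) (M : manifold R 4) (g : riemannian_metric M).

(* Since S is an isometry, the matrix of g in a frame e as in [S_frame] is
      A  B  0 -B
      B  A  B  0
      0  B  A  B
     -B  0  B  A   with A = g(e_1, e_1) and B = g(e_1, e_2). *)
Record skew_circulant_structure := SkewCirculantStructure {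
  S_map :> forall p : M, {linear tangent p -> tangent p};
  S_smooth : forall (U : set M) (X : section M), open U ->
    smooth_field U X -> smooth_field U (fun p => S_map p (X p));
  S_isometry : forall p (x y : tangent p),
    g p (S_map p x) (S_map p y) = g p x y;
  S_frame : forall p, exists (U : set M) (e : 'I_4 -> section M),
    [/\ open U, U p, local_frame U e,
        forall q, U q -> forall i,
          S_map q (e i q) = \sum_j skew_circulant_mx R i j *: e j q
      & forall q, U q ->
          0 < gram g e q 0 1 /\ Num.sqrt 2 * gram g e q 0 1 < gram g e q 0 0] }.

Variable S : skew_circulant_structure.

Definition associated_metric (p : M) (x y : tangent p) : R :=
  g p x (S p y) + g p (S p x) y.

Definition S_invariant_curvature (D : section M -> section M -> section M) : Prop :=
  forall (U : set M) (X Y Z V : section M), open U ->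
    smooth_field U X -> smooth_field U Y ->
    smooth_field U Z -> smooth_field U V ->
    forall p, U p ->
      curvature4 g D (fun q => S q (X q)) (fun q => S q (Y q))
                     (fun q => S q (Z q)) (fun q => S q (V q)) p
      = curvature4 g D X Y Z V p.

Definition almost_einstein (D : section M -> section M -> section M) : Prop :=
  exists alpha beta : M -> R,
    [/\ smooth_on setT alpha, smooth_on setT beta
      & forall (U : set M) (e : 'I_4 -> section M) (X Y : section M),
          open U -> local_frame U e -> smooth_field U X -> smooth_field U Y ->
          forall p, U p ->
            ricci g D e X Y p = alpha p * g p (X p) (Y p)
                                + beta p * associated_metric (X p) (Y p)].

End SkewCirculant.

(* Main.v *)
Require Import Defs.
From mathcomp Require Import ring lra.
Set Implicit Arguments.
Unset Strict Implicit.
Unset Printing Implicit Defensive.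
Local Open Scope classical_set_scope.
Local Open Scope ring_scope.

(** Computing the trace that defines the Ricci tensor [rho] in the frame [S e_i]
    instead of [e_i], the invariance of the curvature under [S] gives
    [rho(Sx, Sy) = rho(x, y)].  Let [C] be the skew-circulant matrix and
    [K = C + C^T], so that [K^2 = 2].  In a frame adapted to [S], a symmetric
    form [r] with [C r C^T = r] has the matrix [a + b K], where [a = r_00] and
    [b = r_01] ([skew_invariant_symE]).  Such forms thus make up a copy of the
    algebra [R[K]/(K^2 - 2)], in which [g] is [A + B K], with [A = g_00] and
    [B = g_01], and the associated metric is [g K] ([associated_matrixE]).  As
    [A > sqrt 2 B > 0], the norm [A^2 - 2 B^2] of [g] is nonzero and [g] is
    invertible in this algebra; the quotient [rho / g = alpha + beta K] is the
    claim ([skew_invariant_decomposition]).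

    The argument uses that [rho] is symmetric and tensorial.  Symmetry comes from
    the pair symmetry of the curvature ([curvature4_pair]), hence from the first
    Bianchi identity, hence from the Jacobi identity for the bracket of
    derivations.  Tensoriality then comes with the symmetries: [R(X,Y,Z,V)(p)]
    involves [V] only through [V(p)], and the symmetries carry each of the other
    three arguments to the last place ([curvature4_comb1] to
    [curvature4_comb4]).

    The values of [alpha] and [beta] at a point are determined by the equation on
    [(e_0, e_0)] and [(e_0, e_1)], a linear system of determinant [A^2 - 2 B^2]
    ([einstein_uniq]).  Functions chosen point by point therefore agree, near each
    point, with the quotients of smooth functions that an adapted frame provides
    ([einstein_local]), and so they are smooth. *)

(** * Calculus of functions of class C^k on open sets *)

Section CkCalculus.
Variables (R : realType) (n : nat).
Implicit Types (U V : set 'rV[R]_n) (f h : 'rV[R]_n -> R).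

Lemma open_near U x : open U -> U x -> \forall y \near x, U y.
Proof. by move=> oU Ux; apply: open_nbhs_nbhs. Qed.

Lemma Ck_eq k U f h : open U -> (forall x, U x -> f x = h x) ->
  Ck k U f -> Ck k U h.
Proof.
move=> oU; elim: k f h => [|k IH] f h fh [cf df];
  have fh_near x (Ux : U x) : {near x, f =1 h}
    by apply: filterS (open_near oU Ux) => y /fh.
all: split=> [x Ux|].
- by rewrite /prop_for /continuous_at -(fh x Ux);
    exact: cvg_trans (near_eq_cvg (fh_near x Ux)) (cf x Ux).
- by [].
- by rewrite /prop_for /continuous_at -(fh x Ux);
    exact: cvg_trans (near_eq_cvg (fh_near x Ux)) (cf x Ux).
move=> i; have [d1 d2] := df i; split=> [x Ux|].
  exact: near_eq_derivable (fh_near x Ux) (d1 x Ux).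
by apply: IH d2 => x Ux; apply: near_eq_derive; apply: fh_near.
Qed.

Lemma Ck_sub k U V f : V `<=` U -> Ck k U f -> Ck k V f.
Proof.
move=> VU; elim: k f => [|k IH] f [cf df]; split=> //; try by move=> x /VU /cf.
by move=> i; have [d1 d2] := df i; split=> [x /VU /d1 //|]; apply: IH.
Qed.

(** The conditions on the derivatives only concern one point at a time, so
    that the neighbourhoods [V] may vary with the point and need not be open. *)
Lemma Ck_local k U f :
  (forall x, U x -> exists2 V, V x & Ck k V f) -> Ck k U f.
Proof.
elim: k f => [|k IH] f loc; split=> //.
- by move=> x /loc [V Vx [cf _]]; apply: cf.
- by move=> x /loc [V Vx [cf _]]; apply: cf.
- move=> i; split=> [x /loc [V Vx [_ df]]|]; first by apply: (df i).1.
  apply: IH => x /loc [V Vx [_ df]]; exists V => //; apply: (df i).2.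
Qed.

Lemma CkS k U f : Ck k.+1 U f -> Ck k U f.
Proof.
elim: k f => [|k IH] f [cf df]; split=> // i.
by have [d1 d2] := df i; split=> //; apply: IH.
Qed.

Lemma Ck_cst k U (a : R) : Ck k U (fun=> a).
Proof.
elim: k a => [|k IH] a; (split; first by move=> x _; apply: cst_continuous) => //.
move=> i; split=> [x _|]; first exact: (derivable_cst a x).
have -> : (fun x : 'rV[R]_n => 'D_(delta_mx 0 i) (fun=> a) x) = (fun=> 0 : R).
  by apply: funext => x; apply: (derive_cst a).
exact: IH.
Qed.

Lemma CkD k U f h : open U -> Ck k U f -> Ck k U h ->
  Ck k U (fun x => f x + h x).
Proof.
move=> oU; elim: k f h => [|k IH] f h [cf df] [ch dh];
  (split; first by move=> x Ux; apply: (cvgD (cf x Ux) (ch x Ux))) => // i.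
have [d1 d2] := df i; have [e1 e2] := dh i; split=> [x Ux|].
  exact: (derivableD (d1 x Ux) (e1 x Ux)).
apply: Ck_eq (IH _ _ d2 e2) => // x Ux.
by rewrite -deriveD //; [apply: d1|apply: e1].
Qed.

(** Induction on [k]: the partial derivatives of the product involve [f] and
    [h] themselves, which are of class C^k by [CkS]. *)
Lemma CkM k U f h : open U -> Ck k U f -> Ck k U h ->
  Ck k U (fun x => f x * h x).
Proof.
move=> oU; elim: k f h => [|k IH] f h Cf Ch;
  (split; first by move=> x Ux; apply: (cvgM (Cf.1 x Ux) (Ch.1 x Ux))) => // i.
have [d1 d2] := Cf.2 i; have [e1 e2] := Ch.2 i; split=> [x Ux|].
  exact: (derivableM (d1 x Ux) (e1 x Ux)).
apply: Ck_eq (CkD oU (IH _ _ (CkS Cf) e2) (IH _ _ (CkS Ch) d2)) => // x Ux.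
by rewrite -[RHS]/('D_(delta_mx 0 i) (f * h) x) deriveM //;
  [apply: d1|apply: e1].
Qed.

Lemma CkV k U f : open U -> (forall x, U x -> f x != 0) ->
  Ck k U f -> Ck k U (fun x => (f x)^-1).
Proof.
move=> oU f0; elim: k => [|k IH] Cf;
  (split; first by move=> x Ux; apply: (cvgV (f0 x Ux) (Cf.1 x Ux))) => // i.
have [d1 d2] := Cf.2 i; split=> [x Ux|].
  exact: (derivableV (f0 x Ux) (d1 x Ux)).
have CV := IH (CkS Cf).
apply: Ck_eq (CkM oU (Ck_cst k U (-1)) (CkM oU (CkM oU CV CV) d2)) => // x Ux.
rewrite deriveV ?f0 //; last exact: d1.
by rewrite mulN1r scaleNr expr2 invfM.
Qed.

End CkCalculus.

(** * Smooth functions on a manifold *)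

Section SmoothFunctions.
Variables (R : realType) (n : nat) (M : manifold R n).
Implicit Types (U V : set M) (f h : M -> R) (p : M).

Lemma chart_preimage_open (c : chart R n M) U : open U ->
  open (chart_img c `&` chart_inv c @^-1` U).
Proof.
move=> oU; rewrite openE => x [cx Ux]; apply: filterI.
  by apply: open_nbhs_nbhs; split=> //; apply: chart_img_open.
exact: (chart_inv_continuous cx (open_nbhs_nbhs (conj oU Ux))).
Qed.

(** Reduces smoothness on an open set to smoothness near each of its points,
    where functions can be replaced by others that agree with them nearby. *)
Lemma smooth_onP U f : open U ->
  smooth_on U f <-> forall p, U p -> smooth_at p f.
Proof.
move=> oU; split=> [sf p Up|loc]; first by exists U.
move=> c ac k; apply: Ck_local => x [cx Ux].
have [V [oV Vx sf]] := loc _ Ux.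
by exists (chart_img c `&` chart_inv c @^-1` V) => //; apply: sf.
Qed.

Lemma smooth_at_near p f : smooth_at p f -> \forall q \near p, smooth_at q f.
Proof.
move=> [U [oU Up sf]]; apply: filterS (open_nbhs_nbhs (conj oU Up)) => q Uq.
by exists U.
Qed.

Lemma smooth_at_eq p f h : (\forall q \near p, f q = h q) ->
  smooth_at p f -> smooth_at p h.
Proof.
rewrite /prop_near1 nbhsE => -[V [oV Vp] fh] [U [oU Up sf]].
exists (U `&` V); split=> //; first exact: openI.
move=> c ac k; have oUV := chart_preimage_open (c := c) (openI oU oV).
apply: (Ck_eq (f := f \o chart_inv c)) => //.
  by move=> x [_ [_ Vx]]; apply: fh.
by apply: Ck_sub (sf c ac k) => x [cx []].
Qed.

Lemma smooth_at_cst p (a : R) : smooth_at p (fun=> a).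
Proof.
by exists setT; split=> //; [apply: openT|move=> c _ k; apply: Ck_cst].
Qed.

(** Both functions are smooth on a common neighbourhood, and composition with a
    chart commutes with pointwise operations. *)
Lemma smooth_at_op2 (op : R -> R -> R) p f h :
  (forall k (W : set 'rV[R]_n) u v, open W -> Ck k W u -> Ck k W v ->
     Ck k W (fun x => op (u x) (v x))) ->
  smooth_at p f -> smooth_at p h -> smooth_at p (fun q => op (f q) (h q)).
Proof.
move=> Cop [U [oU Up sf]] [V [oV Vp sh]].
exists (U `&` V); split=> //; first exact: openI.
move=> c ac k; apply: (Cop _ _ (f \o chart_inv c) (h \o chart_inv c)).
- by apply: chart_preimage_open; apply: openI.
- by apply: Ck_sub (sf c ac k) => x [cx []].
- by apply: Ck_sub (sh c ac k) => x [cx []].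
Qed.

Lemma smooth_atD p f h : smooth_at p f -> smooth_at p h ->
  smooth_at p (fun q => f q + h q).
Proof. by apply: smooth_at_op2 => k U u v; apply: CkD. Qed.

Lemma smooth_atM p f h : smooth_at p f -> smooth_at p h ->
  smooth_at p (fun q => f q * h q).
Proof. by apply: smooth_at_op2 => k U u v; apply: CkM. Qed.

Lemma smooth_atB p f h : smooth_at p f -> smooth_at p h ->
  smooth_at p (fun q => f q - h q).
Proof.
move=> sf sh; apply: smooth_at_eq
  (smooth_atD sf (smooth_atM (smooth_at_cst p (-1)) sh)).
by apply: filterE => q; rewrite mulN1r.
Qed.

Lemma smooth_onV U f : open U -> (forall p, U p -> f p != 0) ->
  smooth_on U f -> smooth_on U (fun p => (f p)^-1).
Proof.
move=> oU f0 sf c ac k; apply: (CkV (f := f \o chart_inv c)); last exact: sf.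
  exact: chart_preimage_open.
by move=> x [_ /f0].
Qed.

Lemma smooth_at_sum p (I : Type) (r : seq I) (P : pred I) (F : I -> M -> R) :
  (forall i, P i -> smooth_at p (F i)) ->
  smooth_at p (fun q => \sum_(i <- r | P i) F i q).
Proof.
move=> sF; elim: r => [|i r IH].
  apply: smooth_at_eq (smooth_at_cst p 0).
  by apply: filterE => q; rewrite big_nil.
have [Pi|nPi] := boolP (P i); last first.
  by apply: smooth_at_eq IH; apply: filterE => q; rewrite big_cons (negPf nPi).
apply: smooth_at_eq (smooth_atD (sF i Pi) IH).
by apply: filterE => q; rewrite big_cons Pi.
Qed.

Lemma smooth_at_prod p (I : Type) (r : seq I) (P : pred I) (F : I -> M -> R) :
  (forall i, P i -> smooth_at p (F i)) ->
  smooth_at p (fun q => \prod_(i <- r | P i) F i q).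
Proof.
move=> sF; elim: r => [|i r IH].
  apply: smooth_at_eq (smooth_at_cst p 1).
  by apply: filterE => q; rewrite big_nil.
have [Pi|nPi] := boolP (P i); last first.
  by apply: smooth_at_eq IH; apply: filterE => q; rewrite big_cons (negPf nPi).
apply: smooth_at_eq (smooth_atM (sF i Pi) IH).
by apply: filterE => q; rewrite big_cons Pi.
Qed.

Lemma smooth_at_det p m (A : M -> 'M[R]_m) :
  (forall i j, smooth_at p (fun q => A q i j)) -> smooth_at p (fun q => \det (A q)).
Proof.
move=> sA; apply: smooth_at_sum => s _; apply: smooth_atM.
  exact: smooth_at_cst.
by apply: smooth_at_prod => i _; exact: sA.
Qed.

(** By Cramer's rule, the entries of the inverse are cofactors over the
    determinant. *)
Lemma smooth_on_invmx U m (A : M -> 'M[R]_m) : open U ->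
  (forall q, U q -> A q \in unitmx) ->
  (forall i j, smooth_on U (fun q => A q i j)) ->
  forall i j, smooth_on U (fun q => invmx (A q) i j).
Proof.
move=> oU uA sA i j; apply/smooth_onP => // p Up.
have sAp a b : smooth_at p (fun q => A q a b) by exists U.
have sdet : smooth_on U (fun q => (\det (A q))^-1).
  apply: smooth_onV => // [q /uA|]; first by rewrite unitmxE unitfE.
  apply/smooth_onP => // q Uq; apply: smooth_at_det => a b.
  by exists U.
apply: (@smooth_at_eq _ (fun q => (\det (A q))^-1 * cofactor (A q) j i)).
  apply: filterS (open_nbhs_nbhs (conj oU Up)) => q /uA uAq.
  by rewrite /invmx uAq !mxE.
apply: smooth_atM; first by exists U.
apply: smooth_atM; first exact: smooth_at_cst.
apply: smooth_at_det => a b; apply: smooth_at_eq (sAp (lift j a) (lift i b)).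
by apply: filterE => q; rewrite !mxE.
Qed.

End SmoothFunctions.

(** * Tangent vectors and the bracket of vector fields *)

Section VectorFields.
Variables (R : realType) (n : nat) (M : manifold R n).
Implicit Types (U V : set M) (f h : M -> R) (p : M) (X Y Z : section M).

Lemma tangent_derivation p (v : tangent p) : is_derivation p v.
Proof. by apply/asboolP; apply: tangentP. Qed.

(** Derivations vanish on the functions that are not smooth at [p], so the
    smooth ones suffice to tell them apart. *)
Lemma tangent_ext p (v w : tangent p) :
  (forall f, smooth_at p f -> v f = w f) -> v = w.
Proof.
move=> vw; apply: val_inj; apply: funext => f.
have [sf|nsf] := pselect (smooth_at p f); first exact: vw.
have [v0 _ _ _] := tangent_derivation v.
have [w0 _ _ _] := tangent_derivation w.
by rewrite [LHS]v0 // [RHS]w0.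
Qed.

Lemma tangentDE p (v w : tangent p) f : (v + w) f = v f + w f.
Proof. by []. Qed.

Lemma tangentNE p (v : tangent p) f : (- v) f = - v f.
Proof. by []. Qed.

Lemma tangent_near p (v : tangent p) f h : smooth_at p f ->
  (\forall q \near p, f q = h q) -> v f = v h.
Proof.
move=> sf fh; have [_ v_eq _ _] := tangent_derivation v.
by apply: v_eq => //; apply: smooth_at_eq sf.
Qed.

Lemma tangentD p (v : tangent p) f h : smooth_at p f -> smooth_at p h ->
  v (fun q => f q + h q) = v f + v h.
Proof.
move=> sf sh; have [_ _ v_lin _] := tangent_derivation v.
rewrite -[v f](mul1r (v f : R)) -v_lin //; congr (v _).
by apply: funext => q; rewrite mul1r.
Qed.

Lemma tangentB p (v : tangent p) f h : smooth_at p f -> smooth_at p h ->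
  v (fun q => f q - h q) = v f - v h.
Proof.
move=> sf sh; have [_ _ v_lin _] := tangent_derivation v.
rewrite -(mulN1r (v h : R)) addrC -v_lin //; congr (v _).
by apply: funext => q; rewrite mulN1r addrC.
Qed.

Lemma smooth_field_sub U V X : V `<=` U -> smooth_field U X -> smooth_field V X.
Proof. by move=> VU sX p /VU /sX. Qed.

(** In [X (Y (f h)) - Y (X (f h))] the products [X f * Y h] and [Y f * X h]
    cancel; the locality of [Y q] at the points [q] near [p] is what makes the
    second derivatives depend on germs only. *)
Lemma bracket_derivation U X Y p : open U -> U p ->
  smooth_field U X -> smooth_field U Y ->
  is_derivation p (fun f => if `[< smooth_at p f >]
    then X p (fun q => Y q f) - Y p (fun q => X q f) else 0).
Proof.
move=> oU Up sX sY; split.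
- by move=> f nsf; case: asboolP.
- move=> f h sf sh fh; rewrite !asboolT //.
  have near_eq Z : (smooth_field U Z) -> \forall q \near p, Z q f = Z q h.
    move=> sZ; have nn := near_join fh.
    apply: filterS2 nn (smooth_at_near sf) => q fhq sfq.
    exact: tangent_near.
  by congr (_ - _); apply: tangent_near; [apply: sY|apply: near_eq|apply: sX|
    apply: near_eq].
- move=> a f h sf sh; have sfh := smooth_atD (smooth_atM (smooth_at_cst p a) sf) sh.
  rewrite !asboolT //.
  have E Z W : smooth_field U Z -> smooth_field U W ->
      Z p (fun q => W q (fun q => a * f q + h q))
      = a * Z p (fun q => W q f) + Z p (fun q => W q h).
    move=> sZ sW; have [_ _ Z_lin _] := tangent_derivation (Z p).
    rewrite -Z_lin; [|exact: sW|exact: sW].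
    apply: tangent_near; first exact: sW.
    apply: filterS2 (smooth_at_near sf) (smooth_at_near sh) => q sfq shq.
    by have [_ _ W_lin _] := tangent_derivation (W q); rewrite W_lin.
  by rewrite !E // mulrBr opprD addrACA.
- move=> f h sf sh; have sfh := smooth_atM sf sh.
  rewrite !asboolT //.
  have E Z W : smooth_field U Z -> smooth_field U W ->
      Z p (fun q => W q (fun q => f q * h q))
      = Z p (fun q => W q f) * h p + W p f * Z p h
        + (Z p f * W p h + f p * Z p (fun q => W q h)).
    move=> sZ sW; have [_ _ _ Z_mul] := tangent_derivation (Z p).
    rewrite -Z_mul; [|exact: sW|exact: sh].
    rewrite -Z_mul; [|exact: sf|exact: sW].
    rewrite -tangentD; [|by apply: smooth_atM sh; apply: sW
      |by apply: smooth_atM sf _; apply: sW].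
    apply: tangent_near; first exact: sW.
    apply: filterS2 (smooth_at_near sf) (smooth_at_near sh) => q sfq shq.
    by have [_ _ _ W_mul] := tangent_derivation (W q); rewrite W_mul.
  rewrite !E //; move: (X p f) (Y p f) (X p h) (Y p h) => /= a b c d.
  move: (X p _) (Y p _) (X p _) (Y p _) => /= u v w z.
  rewrite mulrBl mulrBr; rewrite /GRing.regular /= in a b c d u v w z *.
  ring.
Qed.

Lemma lie_bracketE U X Y p f : open U -> U p ->
  smooth_field U X -> smooth_field U Y -> smooth_at p f ->
  lie_bracket X Y p f = X p (fun q => Y q f) - Y p (fun q => X q f).
Proof.
move=> oU Up sX sY sf.
rewrite /lie_bracket -[LHS]/(val (insubd _ _) f) insubdK; first by rewrite asboolT.
by apply/asboolP; apply: bracket_derivation Up sX sY.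
Qed.

Lemma smooth_bracket U X Y : open U ->
  smooth_field U X -> smooth_field U Y -> smooth_field U (lie_bracket X Y).
Proof.
move=> oU sX sY p Up f sf.
apply: smooth_at_eq (smooth_atB (sX p Up _ (sY p Up f sf)) (sY p Up _ (sX p Up f sf))).
apply: filterS2 (open_nbhs_nbhs (conj oU Up)) (smooth_at_near sf) => q Uq sfq.
by rewrite (lie_bracketE oU).
Qed.

Lemma lie_bracketC U X Y p : open U -> U p ->
  smooth_field U X -> smooth_field U Y ->
  lie_bracket Y X p = - lie_bracket X Y p.
Proof.
move=> oU Up sX sY; apply: tangent_ext => f sf.
by rewrite tangentNE !(lie_bracketE oU) // opprB.
Qed.

(** Spelling out iterated brackets as second-order operators turns the Jacobi
    identity into a cancellation of twelve terms. *)
Lemma lie_bracket_bracketE U X Y Z p f : open U -> U p ->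
  smooth_field U X -> smooth_field U Y -> smooth_field U Z -> smooth_at p f ->
  lie_bracket X (lie_bracket Y Z) p f =
    X p (fun q => Y q (fun q => Z q f)) - X p (fun q => Z q (fun q => Y q f))
    - (Y p (fun q => Z q (fun q => X q f)) - Z p (fun q => Y q (fun q => X q f))).
Proof.
move=> oU Up sX sY sZ sf.
rewrite (lie_bracketE oU Up sX (smooth_bracket oU sY sZ) sf).
rewrite (lie_bracketE oU Up sY sZ (sX p Up f sf)); congr (_ - _).
rewrite -tangentB; [|by apply: sY => //; apply: sZ|by apply: sZ => //; apply: sY].
apply: tangent_near; first exact: smooth_bracket oU sY sZ _ Up _ sf.
apply: filterS2 (open_nbhs_nbhs (conj oU Up)) (smooth_at_near sf) => q Uq sfq.
exact: lie_bracketE oU Uq sY sZ sfq.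
Qed.

Lemma jacobi_identity U X Y Z p : open U -> U p ->
  smooth_field U X -> smooth_field U Y -> smooth_field U Z ->
  lie_bracket X (lie_bracket Y Z) p + lie_bracket Y (lie_bracket Z X) p
  + lie_bracket Z (lie_bracket X Y) p = 0.
Proof.
move=> oU Up sX sY sZ; apply: tangent_ext => f sf.
rewrite !tangentDE !(lie_bracket_bracketE oU Up) //.
rewrite -[RHS]/(0 : R).
have jac (a b c d e h : R) :
  a - b - (c - d) + (c - e - (h - b)) + (h - d - (a - e)) = 0 by ring.
exact: jac.
Qed.

End VectorFields.

(** * The metric and the symmetries of the curvature *)

Section Metric.
Variables (R : realType) (n : nat) (M : manifold R n) (g : riemannian_metric M).
Variable p : M.
Implicit Types x y z : tangent p.

Lemma metricDl x y z : g p (x + y) z = g p x z + g p y z.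
Proof. by rewrite -[x]scale1r metric_linear mul1r scale1r. Qed.

Lemma metric0l z : g p 0 z = 0.
Proof. by apply: (addrI (g p 0 z)); rewrite -metricDl !addr0. Qed.

Lemma metricZl (a : R) x z : g p (a *: x) z = a * g p x z.
Proof. by rewrite -[a *: x]addr0 metric_linear metric0l addr0. Qed.

Lemma metricBl x y z : g p (x - y) z = g p x z - g p y z.
Proof. by rewrite metricDl -scaleN1r metricZl mulN1r. Qed.

Lemma metric_suml (I : finType) (a : I -> R) (x : I -> tangent p) z :
  g p (\sum_i a i *: x i) z = \sum_i a i * g p (x i) z.
Proof.
elim/big_rec2: _ => [|i u v _ <-]; first exact: metric0l.
exact: metric_linear.
Qed.

Lemma metric_sumr (I : finType) (a : I -> R) (x : I -> tangent p) z :
  g p z (\sum_i a i *: x i) = \sum_i a i * g p z (x i).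
Proof.
by rewrite metric_sym metric_suml; apply: eq_bigr => i _; rewrite metric_sym.
Qed.

End Metric.

Section Curvature.
Variables (R : realType) (n : nat) (M : manifold R n) (g : riemannian_metric M).
Variable D : section M -> section M -> section M.
Hypothesis LC : levi_civita g D.
Variable U : set M.
Hypothesis oU : open U.
Implicit Types X Y Z V : section M.

Let sD X Y : smooth_field U X -> smooth_field U Y -> smooth_field U (D X Y).
Proof. by move=> sX sY; apply: (connection_smooth (levi_civita_connection LC) oU). Qed.

Lemma smooth_curvature X Y Z : smooth_field U X -> smooth_field U Y ->
  smooth_field U Z -> smooth_field U (curvature D X Y Z).
Proof.
move=> sX sY sZ p Up f sf.
have sDXYZ := sD sX (sD sY sZ) Up sf.
have sDYXZ := sD sY (sD sX sZ) Up sf.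
have sDLZ := sD (smooth_bracket oU sX sY) sZ Up sf.
exact: smooth_atB (smooth_atB sDXYZ sDYXZ) sDLZ.
Qed.

Lemma smooth_curvature4 X Y Z V : smooth_field U X -> smooth_field U Y ->
  smooth_field U Z -> smooth_field U V -> smooth_on U (curvature4 g D X Y Z V).
Proof.
by move=> sX sY sZ sV; apply: metric_smooth => //; apply: smooth_curvature.
Qed.

(** The torsion-free identity holds on all of [U], and by locality of the
    connection it can therefore be differentiated. *)
Lemma connection_bracket X Y Z p : U p ->
  smooth_field U X -> smooth_field U Y -> smooth_field U Z ->
  D X (D Y Z) p = D X (lie_bracket Y Z) p + D X (D Z Y) p.
Proof.
move=> Up sX sY sZ; have cD := levi_civita_connection LC.
have sYZ := smooth_bracket oU sY sZ; have sDZY := sD sZ sY.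
rewrite -(connection_addr cD oU) //.
apply: (connection_local cD oU) => //; first exact: sD.
  by move=> q Uq f sf; apply: smooth_atD; [apply: sYZ|apply: sDZY].
by move=> q Uq; rewrite -(levi_civita_torsion_free LC oU) // subrK.
Qed.

(** Grouping the six second derivatives in pairs, [D_X D_Y Z - D_X D_Z Y] is
    [D_X [Y, Z]], and a second use of the vanishing torsion leaves the Jacobi sum
    of iterated brackets. *)
Lemma first_bianchi X Y Z p : U p ->
  smooth_field U X -> smooth_field U Y -> smooth_field U Z ->
  curvature D X Y Z p + curvature D Y Z X p + curvature D Z X Y p = 0.
Proof.
move=> Up sX sY sZ; rewrite -(jacobi_identity oU Up sX sY sZ) /curvature.
rewrite (connection_bracket Up sX sY sZ) (connection_bracket Up sY sZ sX).
rewrite (connection_bracket Up sZ sX sY).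
rewrite -!(levi_civita_torsion_free LC oU _ _ Up) //; try exact: smooth_bracket.
apply: tangent_ext => f sf.
have rearrange (a b c d e h u v w : R) :
    d + a - b - u + (e + b - c - v) + (h + c - a - w)
    = d - v + (e - w) + (h - u) by ring.
exact: rearrange.
Qed.

Lemma curvature4_anti12 X Y Z V p : U p -> smooth_field U X -> smooth_field U Y ->
  smooth_field U Z -> curvature4 g D Y X Z V p = - curvature4 g D X Y Z V p.
Proof.
move=> Up sX sY sZ; have cD := levi_civita_connection LC.
have E : D (lie_bracket Y X) Z p = - D (lie_bracket X Y) Z p.
  have sXY := smooth_bracket oU sX sY.
  rewrite -scaleN1r -(connection_scalel cD oU (f := fun=> -1) _ sXY sZ Up);
    last by move=> c _ k; apply: Ck_cst.
  apply: (connection_local cD oU) => //; first exact: smooth_bracket.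
    move=> q Uq f sf; apply: smooth_atM; first exact: smooth_at_cst.
    exact: sXY.
  by move=> q Uq; rewrite (lie_bracketC oU Uq sX sY) scaleN1r.
rewrite /curvature4 -(mulN1r (g p _ _)) -metricZl; congr (g p _ _).
by rewrite /curvature E scaleN1r !opprB opprK [RHS]addrC addrAC.
Qed.

(** The operator [X Y - Y X - [X, Y]] vanishes on the function [g(Z, V)];
    expanding it with the compatibility of the metric gives
    [R(X,Y,Z,V) + R(X,Y,V,Z)]. *)
Lemma curvature4_anti34 X Y Z V p : U p -> smooth_field U X -> smooth_field U Y ->
  smooth_field U Z -> smooth_field U V ->
  curvature4 g D X Y V Z p = - curvature4 g D X Y Z V p.
Proof.
move=> Up sX sY sZ sV.
have sgZV : smooth_at p (fun q => g q (Z q) (V q)).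
  by exists U; split=> //; apply: metric_smooth.
have second A B : smooth_field U A -> smooth_field U B ->
    A p (fun q => B q (fun q => g q (Z q) (V q))) =
    g p (D A (D B Z) p) (V p) + g p (D B Z p) (D A V p)
    + (g p (D A Z p) (D B V p) + g p (Z p) (D A (D B V) p)).
  move=> sA sB; have sDZ := sD sB sZ; have sDV := sD sB sV.
  rewrite -!(levi_civita_metric LC oU) // -tangentD;
    try by exists U; split=> //; apply: metric_smooth.
  apply: tangent_near; first exact: sB.
  apply: filterS (open_nbhs_nbhs (conj oU Up)) => q Uq.
  exact: (levi_civita_metric LC oU).
have := lie_bracketE oU Up sX sY sgZV.
have sXY := smooth_bracket oU sX sY.
rewrite (levi_civita_metric LC oU) // !second //.
rewrite /curvature4 /curvature !metricBl !(metric_sym g (Z p)).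
by move=> E; lra.
Qed.

(** The four Bianchi sums obtained by rotating [X, Y, Z, V] combine, after the
    antisymmetries have brought their twelve terms to six, into twice this
    identity. *)
Lemma curvature4_pair X Y Z V p : U p -> smooth_field U X -> smooth_field U Y ->
  smooth_field U Z -> smooth_field U V ->
  curvature4 g D Z V X Y p = curvature4 g D X Y Z V p.
Proof.
move=> Up sX sY sZ sV; set r := curvature4 g D.
have bianchi A B C W : smooth_field U A -> smooth_field U B -> smooth_field U C ->
    r A B C W p + r B C A W p + r C A B W p = 0.
  by move=> *; rewrite /r /curvature4 -!metricDl first_bianchi // metric0l.
have a12 A B C W : smooth_field U A -> smooth_field U B -> smooth_field U C ->
    r B A C W p = - r A B C W p by move=> *; apply: curvature4_anti12.
have a34 A B C W : smooth_field U A -> smooth_field U B -> smooth_field U C ->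
    smooth_field U W -> r A B W C p = - r A B C W p.
  by move=> *; apply: curvature4_anti34.
have := bianchi X Y Z V sX sY sZ; have := bianchi Y Z V X sY sZ sV.
have := bianchi Z V X Y sZ sV sX; have := bianchi V X Y Z sV sX sY.
rewrite (a34 Y Z X V) // (a34 Z V X Y) // (a12 Z X V Y) // (a34 Z X Y V) //.
rewrite (a34 V X Z Y) // (a34 X Y Z V) // (a12 V Y X Z) // (a34 V Y Z X) //.
lra.
Qed.

End Curvature.

(** * Gram matrices, tensoriality and the Ricci tensor *)

Lemma mulmx_bilinE (R : comPzRingType) m n k l (x : 'M[R]_(m, k)) (A : 'M[R]_(k, l))
    (y : 'M[R]_(n, l)) i j :
  (x *m A *m y^T) i j = \sum_a x i a * \sum_b y j b * A a b.
Proof.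
rewrite -mulmxA mxE; apply: eq_bigr => a _; congr (_ * _).
by rewrite mxE; apply: eq_bigr => b _; rewrite mxE mulrC.
Qed.

Section Gram.
Variables (R : realType) (n : nat) (M : manifold R n) (g : riemannian_metric M).
Implicit Types (U : set M) (e f : 'I_n -> section M).

Lemma metric_coord e p (x y : 'rV_n) (v w : tangent p) :
  v = \sum_i x 0 i *: e i p -> w = \sum_i y 0 i *: e i p ->
  g p v w = (x *m gram g e p *m y^T) 0 0.
Proof.
move=> -> ->; rewrite mulmx_bilinE metric_suml; apply: eq_bigr => a _.
rewrite metric_sumr; congr (_ * _); apply: eq_bigr => b _.
by rewrite mxE.
Qed.

Lemma gram_change e f p (E : 'M[R]_n) : (forall i, e i p = \sum_j E i j *: f j p) ->
  gram g e p = E *m gram g f p *m E^T.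
Proof.
move=> eE; apply/matrixP => i j.
rewrite mulmx_bilinE mxE !eE metric_suml; apply: eq_bigr => a _.
rewrite metric_sumr; congr (_ * _); apply: eq_bigr => b _.
by rewrite mxE.
Qed.

Lemma gram_sym e p : (gram g e p)^T = gram g e p.
Proof. by apply/matrixP => i j; rewrite !mxE metric_sym. Qed.

(** A vector in the kernel of the Gram matrix is the coordinate vector of a
    tangent vector of length zero. *)
Lemma gram_unitmx U e p : local_frame U e -> U p -> gram g e p \in unitmx.
Proof.
move=> [_ fr] Up; rewrite -row_free_unit; apply: inj_row_free => v vG.
have [w0 | w_neq0] := eqVneq (\sum_i v 0 i *: e i p) 0.
  have [c [_ c_uniq]] := fr p Up 0; rewrite -(c_uniq v) // -(c_uniq 0) //.
  by rewrite big1 // => i _; rewrite mxE scale0r.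
have := metric_pos g w_neq0.
by rewrite (metric_coord (x := v) (y := v) (e := e)) // vG mul0mx mxE ltxx.
Qed.

Lemma frame_coord U f p (v : tangent p) : local_frame U f -> U p ->
  exists x : 'rV_n, v = \sum_i x 0 i *: f i p.
Proof. by move=> [_ fr] Up; have [x [vx _]] := fr p Up v; exists x. Qed.

Lemma frame_transition U f e p : local_frame U f -> U p ->
  exists E : 'M[R]_n, forall i, e i p = \sum_j E i j *: f j p.
Proof.
move=> fr Up; have [x xP] := choice (fun i => frame_coord (e i p) fr Up).
exists (\matrix_i x i) => i; rewrite [LHS]xP; apply: eq_bigr => j _.
by rewrite mxE.
Qed.

End Gram.

Section Ricci.
Variables (R : realType) (n : nat) (M : manifold R n) (g : riemannian_metric M).
Variable D : section M -> section M -> section M.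
Hypothesis LC : levi_civita g D.
Variables (U : set M) (p : M).
Hypotheses (oU : open U) (Up : U p).
Implicit Types (X Y Z V : section M) (e f : 'I_n -> section M).

(** Here and in the next three lemmas the decomposition is only required at the
    point [p]: this is tensoriality. *)
Lemma curvature4_comb4 (a : 'I_n -> R) X Y Z V f :
  V p = \sum_i a i *: f i p ->
  curvature4 g D X Y Z V p = \sum_i a i * curvature4 g D X Y Z (f i) p.
Proof. by rewrite /curvature4 => ->; rewrite metric_sumr. Qed.

Section Tensoriality.
Variables (X Y Z V : section M) (f : 'I_n -> section M) (a : 'I_n -> R).
Hypotheses (sX : smooth_field U X) (sY : smooth_field U Y)
  (sZ : smooth_field U Z) (sV : smooth_field U V)
  (sf : forall i, smooth_field U (f i)).

Lemma curvature4_comb3 : Z p = \sum_i a i *: f i p ->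
  curvature4 g D X Y Z V p = \sum_i a i * curvature4 g D X Y (f i) V p.
Proof.
move=> Zf; rewrite (curvature4_anti34 LC oU) // (curvature4_comb4 _ _ _ Zf).
rewrite -sumrN; apply: eq_bigr => i _.
by rewrite -mulrN -(curvature4_anti34 LC oU).
Qed.

Lemma curvature4_comb2 : Y p = \sum_i a i *: f i p ->
  curvature4 g D X Y Z V p = \sum_i a i * curvature4 g D X (f i) Z V p.
Proof.
move=> Yf; rewrite -(curvature4_pair LC oU) // (curvature4_comb4 _ _ _ Yf).
by apply: eq_bigr => i _; rewrite (curvature4_pair LC oU).
Qed.

End Tensoriality.

Lemma curvature4_comb1 X Y Z V f (a : 'I_n -> R) : smooth_field U X ->
  smooth_field U Y -> smooth_field U Z -> smooth_field U V ->
  (forall i, smooth_field U (f i)) -> X p = \sum_i a i *: f i p ->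
  curvature4 g D X Y Z V p = \sum_i a i * curvature4 g D (f i) Y Z V p.
Proof.
move=> sX sY sZ sV sf Xf; rewrite -(curvature4_pair LC oU) //.
rewrite (curvature4_comb3 _ _ _ _ _ Xf) //.
by apply: eq_bigr => i _; rewrite (curvature4_pair LC oU).
Qed.

(** Up to an exchange of the two trace indices, this is the pair symmetry of the
    curvature. *)
Lemma ricci_sym e Y Z : (forall i, smooth_field U (e i)) ->
  smooth_field U Y -> smooth_field U Z ->
  ricci g D e Z Y p = ricci g D e Y Z p.
Proof.
move=> se sY sZ; rewrite /ricci exchange_big; apply: eq_bigr => i _.
apply: eq_bigr => j _; congr (_ * _).
  by rewrite -[in RHS](gram_sym g e) -trmx_inv [RHS]mxE.
rewrite -(curvature4_pair LC oU) // (curvature4_anti12 LC oU) //.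
by rewrite (curvature4_anti34 LC oU) // opprK.
Qed.

Lemma ricci_combl e f Y Z (a : 'I_n -> R) :
  (forall i, smooth_field U (e i)) -> (forall i, smooth_field U (f i)) ->
  smooth_field U Y -> smooth_field U Z -> Y p = \sum_i a i *: f i p ->
  ricci g D e Y Z p = \sum_i a i * ricci g D e (f i) Z p.
Proof.
move=> se sf sY sZ Yf; rewrite /ricci.
under [RHS]eq_bigr do rewrite mulr_sumr.
rewrite [RHS]exchange_big; apply: eq_bigr => i _ /=.
under [RHS]eq_bigr do rewrite mulr_sumr.
rewrite [RHS]exchange_big; apply: eq_bigr => j _ /=.
rewrite (curvature4_comb2 _ _ _ _ _ Yf) // mulr_sumr; apply: eq_bigr => k _.
by rewrite mulrCA.
Qed.

Lemma ricci_combr e f Y Z (a : 'I_n -> R) :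
  (forall i, smooth_field U (e i)) -> (forall i, smooth_field U (f i)) ->
  smooth_field U Y -> smooth_field U Z -> Z p = \sum_i a i *: f i p ->
  ricci g D e Y Z p = \sum_i a i * ricci g D e Y (f i) p.
Proof.
move=> se sf sY sZ Zf; rewrite ricci_sym // (ricci_combl se sf sZ sY Zf).
by apply: eq_bigr => i _; rewrite ricci_sym.
Qed.

(** With [G] the Gram matrix and [T] the matrix of the curvature components, the
    Ricci tensor is [tr (G^-1 T^T)]; the change of frame [E] turns [G] and [T] into
    [E G E^T] and [E T E^T]. *)
Lemma ricci_frame e f Y Z (E : 'M[R]_n) :
  (forall i, smooth_field U (e i)) -> (forall i, smooth_field U (f i)) ->
  smooth_field U Y -> smooth_field U Z -> gram g e p \in unitmx ->
  (forall i, e i p = \sum_j E i j *: f j p) ->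
  ricci g D e Y Z p = ricci g D f Y Z p.
Proof.
move=> se sf sY sZ.
pose Rm (h : 'I_n -> section M) :=
  \matrix_(i, j) curvature4 g D (h i) Y Z (h j) p.
have ricci_tr h : ricci g D h Y Z p = \tr (invmx (gram g h p) *m (Rm h)^T).
  rewrite /mxtrace; apply: eq_bigr => i _; rewrite mxE.
  by apply: eq_bigr => j _; rewrite !mxE.
move=> uG eE; have GE := gram_change g eE.
move: uG; rewrite GE !unitmx_mul unitmx_tr => /andP[/andP[uE uG] _].
have RmE : Rm e = E *m Rm f *m E^T.
  apply/matrixP => i j; rewrite mulmx_bilinE mxE (curvature4_comb1 _ _ _ _ _ (eE i)) //.
  apply: eq_bigr => a _; rewrite (curvature4_comb4 _ _ _ (eE j)); congr (_ * _).
  by apply: eq_bigr => b _; rewrite mxE.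
have invG : E^T *m invmx (gram g e p) *m E = invmx (gram g f p).
  apply: (can_inj (mulKmx uG)); apply: (can_inj (mulKmx uE)).
  rewrite mulmxV // mulmx1 !mulmxA -GE mulmxV ?mul1mx //.
  by rewrite GE !unitmx_mul unitmx_tr uE uG.
rewrite !ricci_tr -invG RmE !trmx_mul trmxK !mulmxA.
by rewrite [LHS]mxtrace_mulC !mulmxA.
Qed.

End Ricci.

(** * The algebra of symmetric skew-circulant-invariant matrices *)

Section SkewCirculantMatrices.
Variable R : realType.
Local Notation C := (skew_circulant_mx R).
Local Notation K := (C + C^T).

Lemma skew_circulant_orthogonal : C *m C^T = 1%:M.
Proof.
apply/matrixP => i j; rewrite !mxE !big_ord_recl big_ord0 !mxE /bump /=.
by case: i => [[|[|[|[|//]]]] ?]; case: j => [[|[|[|[|//]]]] ?]; rewrite /=; ring.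
Qed.

(** Since [C^4 = -1] and [C^T = C^-1], one has [(C^T)^2 = - C^2]; together with
    [skew_circulant_orthogonal] this gives [(C + C^T)^2 = 2]. *)
Lemma skew_circulant_sqr_anti : C *m C + C^T *m C^T = 0.
Proof.
apply/matrixP => i j; rewrite !mxE !big_ord_recl !big_ord0 !mxE /bump /=.
by case: i => [[|[|[|[|//]]]] ?]; case: j => [[|[|[|[|//]]]] ?] /=; ring.
Qed.

(** Invariance shifts both indices by one, up to the sign picked up when an index
    passes from 3 to 0.  Hence the diagonal is constant, the first off-diagonal is
    constant and reappears as [r_03 = - r_01], and [r_02 = r_13 = - r_20], which
    symmetry forces to vanish. *)
Lemma skew_invariant_symE (r : 'M[R]_4) : r^T = r -> C *m r *m C^T = r ->
  r = (r 0 0)%:M + r 0 1 *: K.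
Proof.
(* Indexing the entries by natural numbers makes equal entries syntactically
   equal, whatever form their ordinals take after the sums are expanded. *)
move=> r_sym r_inv; pose s (a b : nat) := r (inord a) (inord b).
have rE (i j : 'I_4) : r i j = s i j by rewrite /s !inord_val.
have sC i j : s i j = s j i by rewrite /s -[in LHS]r_sym mxE.
have shift (i j : 'I_4) : \sum_a C i a * (\sum_b C j b * s a b) = s i j.
  rewrite -rE -[in RHS]r_inv mulmx_bilinE; apply: eq_bigr => a _.
  by congr (_ * _); apply: eq_bigr => b _; rewrite rE.
pose o k (lt_k4 : (k < 4)%N) := Ordinal lt_k4.
have := (shift (@o 0 isT) (@o 0 isT), shift (@o 1 isT) (@o 1 isT),
  shift (@o 2 isT) (@o 2 isT), shift (@o 0 isT) (@o 1 isT),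
  shift (@o 1 isT) (@o 2 isT), shift (@o 2 isT) (@o 3 isT),
  shift (@o 0 isT) (@o 2 isT), shift (@o 1 isT) (@o 3 isT)).
rewrite !big_ord_recl !big_ord0 !mxE /bump /= => -[[[[[[[]]]]]]].
rewrite ?(sC 1 0)%N ?(sC 2 0)%N ?(sC 3 0)%N ?(sC 2 1)%N ?(sC 3 1)%N ?(sC 3 2)%N.
move=> s11 s22 s33 s12 s23 s30 s13 s20.
apply/matrixP => i j; rewrite !mxE !rE /=.
case: i => [[|[|[|[|//]]]] ?]; case: j => [[|[|[|[|//]]]] ?] /=;
rewrite ?(sC 1 0)%N ?(sC 2 0)%N ?(sC 3 0)%N ?(sC 2 1)%N ?(sC 3 1)%N ?(sC 3 2)%N; lra.
Qed.

(** For [G = A + B K], the left-hand side is [A K + B (C K + K C^T)], and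
    [C K + K C^T = C^2 + 2 + (C^T)^2 = 2]: this is [G K]. *)
Lemma associated_matrixE (G : 'M[R]_4) : G^T = G -> C *m G *m C^T = G ->
  G *m C^T + C *m G = (2 * G 0 1)%:M + G 0 0 *: K.
Proof.
move=> G_sym G_inv; rewrite {1 2}(skew_invariant_symE G_sym G_inv).
have CTCT : C^T *m C^T = - (C *m C).
  by apply/eqP; rewrite -addr_eq0 addrC skew_circulant_sqr_anti.
rewrite mulmxDl mulmxDr mul_scalar_mx mul_mx_scalar -scalemxAl -scalemxAr.
rewrite mulmxDl mulmxDr skew_circulant_orthogonal CTCT.
move: (G 0 0) (G 0 1) (C *m C) => a b C2.
by apply/matrixP => i j; rewrite !mxE; ring.
Qed.

(** The coefficients are those of the quotient [(a + b K) / (A + B K)], computed by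
    multiplying with the conjugate [A - B K]. *)
Lemma skew_invariant_decomposition (r G : 'M[R]_4) :
  r^T = r -> C *m r *m C^T = r -> G^T = G -> C *m G *m C^T = G ->
  let d := G 0 0 ^+ 2 - 2 * G 0 1 ^+ 2 in d != 0 ->
  r = ((r 0 0 * G 0 0 - 2 * r 0 1 * G 0 1) / d) *: G
      + ((r 0 1 * G 0 0 - r 0 0 * G 0 1) / d) *: (G *m C^T + C *m G).
Proof.
move=> r_sym r_inv G_sym G_inv d d0.
rewrite associated_matrixE // [X in _ *: X + _](skew_invariant_symE G_sym G_inv).
rewrite [LHS](skew_invariant_symE r_sym r_inv); move: K => K'.
rewrite !scalerDr !scalerA !scale_scalar_mx addrACA -raddfD -scalerDl /=.
move: d0; rewrite /d.
move: (r 0 0) (r 0 1) (G 0 0) (G 0 1) => a b A B d0.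
by congr (_%:M + _ *: _); field.
Qed.

End SkewCirculantMatrices.

(** * The Ricci tensor in a frame adapted to S *)

Section SkewFrame.
Variables (R : realType) (M : manifold R 4) (g : riemannian_metric M)
  (S : skew_circulant_structure g) (D : section M -> section M -> section M).
Hypotheses (LC : levi_civita g D) (S_inv : S_invariant_curvature S D).
Variables (U : set M) (f : 'I_4 -> section M).
Hypotheses (oU : open U) (frame_f : local_frame U f).
Local Notation C := (skew_circulant_mx R).
Hypothesis Sf : forall q, U q -> forall i, S q (f i q) = \sum_j C i j *: f j q.
Hypothesis pos_f : forall q, U q ->
  0 < gram g f q 0 1 /\ Num.sqrt 2 * gram g f q 0 1 < gram g f q 0 0.

Let sf : forall i, smooth_field U (f i) := frame_f.1.
Let F i : section M := fun q => S q (f i q).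
Let sF i : smooth_field U (F i). Proof. exact: (S_smooth S oU (sf i)). Qed.

Definition ricci_mx q : 'M[R]_4 := \matrix_(a, b) ricci g D f (f a) (f b) q.

Section AtPoint.
Variable p : M.
Hypothesis Up : U p.

Lemma gram_S : gram g F p = gram g f p.
Proof. by apply/matrixP => i j; rewrite !mxE S_isometry. Qed.

Lemma gram_S_inv : C *m gram g f p *m C^T = gram g f p.
Proof. by rewrite -[RHS]gram_S (gram_change g (Sf Up)). Qed.

Lemma ricci_mx_sym : (ricci_mx p)^T = ricci_mx p.
Proof. by apply/matrixP => a b; rewrite !mxE (ricci_sym LC oU Up). Qed.

(** The components on [S f_a] and [S f_b] are computed in the frame [S f], whose
    Gram matrix is that of [f], and there the invariance of the curvature applies
    term by term. *)
Lemma ricci_mx_S_inv : C *m ricci_mx p *m C^T = ricci_mx p.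
Proof.
apply/matrixP => a b; rewrite mulmx_bilinE.
transitivity (ricci g D f (F a) (F b) p).
  rewrite (ricci_combl LC oU Up _ _ _ _ (Sf Up a)) //; apply: eq_bigr => i _.
  rewrite (ricci_combr LC oU Up _ _ _ _ (Sf Up b)) //; congr (_ * _).
  by apply: eq_bigr => j _; rewrite [ricci_mx p i j]mxE.
have uG := gram_unitmx g frame_f Up.
rewrite -(ricci_frame LC oU Up (e := F) (E := C)) ?gram_S //; last exact: Sf.
rewrite mxE /ricci gram_S; apply: eq_bigr => i _; apply: eq_bigr => j _.
by congr (_ * _); apply: S_inv oU _ _ _ _ _ Up.
Qed.

(** In coordinates with respect to [f], the map [S] sends the row [z] to [z C]. *)
Lemma associated_metric_coord (x y : 'rV[R]_4) (v w : tangent p) :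
  v = \sum_i x 0 i *: f i p -> w = \sum_i y 0 i *: f i p ->
  associated_metric S v w
  = (x *m (gram g f p *m C^T + C *m gram g f p) *m y^T) 0 0.
Proof.
have S_coord (z : 'rV[R]_4) (u : tangent p) : u = \sum_i z 0 i *: f i p ->
    S p u = \sum_j (z *m C) 0 j *: f j p.
  move=> ->; rewrite linear_sum /=.
  transitivity (\sum_i \sum_j (z 0 i * C i j) *: f j p).
    apply: eq_bigr => i _; rewrite linearZ /= Sf // scaler_sumr.
    by apply: eq_bigr => j _; rewrite scalerA.
  rewrite exchange_big; apply: eq_bigr => j _ /=.
  by rewrite mxE scaler_suml.
move=> xv yw; rewrite /associated_metric.
rewrite (metric_coord g xv (S_coord _ _ yw)) (metric_coord g (S_coord _ _ xv) yw).
by rewrite trmx_mul mulmxDr mulmxDl !mulmxA [RHS]mxE.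
Qed.

Lemma skew_discriminant_neq0 :
  gram g f p 0 0 ^+ 2 - 2 * gram g f p 0 1 ^+ 2 != 0.
Proof.
have [B0 AB] := pos_f Up; move: (gram g f p 0 0) (gram g f p 0 1) B0 AB => A B B0 AB.
have sqrt2 : Num.sqrt 2 ^+ 2 = 2 :> R by rewrite sqr_sqrtr.
have s0 : 0 <= Num.sqrt 2 :> R by apply: sqrtr_ge0.
have : (Num.sqrt 2 * B) ^+ 2 < A ^+ 2.
  by rewrite ltr_pXn2r // nnegrE; [apply: mulr_ge0 => //; lra|nra].
by rewrite exprMn sqrt2 -subr_gt0 => /lt0r_neq0.
Qed.

End AtPoint.

(** With [einstein_beta], the coordinates of the quotient of the Ricci tensor by the
    metric in the algebra of [skew_invariant_decomposition]. *)
Definition einstein_alpha q : R :=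
  (ricci_mx q 0 0 * gram g f q 0 0 - 2 * ricci_mx q 0 1 * gram g f q 0 1)
  / (gram g f q 0 0 ^+ 2 - 2 * gram g f q 0 1 ^+ 2).

Definition einstein_beta q : R :=
  (ricci_mx q 0 1 * gram g f q 0 0 - ricci_mx q 0 0 * gram g f q 0 1)
  / (gram g f q 0 0 ^+ 2 - 2 * gram g f q 0 1 ^+ 2).

Lemma smooth_gram i j : smooth_on U (fun q => gram g f q i j).
Proof.
apply/smooth_onP => // p Up.
apply: (@smooth_at_eq _ _ _ _ (fun q => g q (f i q) (f j q))).
  by apply: filterE => q; rewrite mxE.
by exists U; split=> //; apply: metric_smooth.
Qed.

Lemma smooth_ricci_mx a b : smooth_on U (fun q => ricci_mx q a b).
Proof.
apply/smooth_onP => // p Up.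
apply: (@smooth_at_eq _ _ _ _ (fun q => ricci g D f (f a) (f b) q)).
  by apply: filterE => q; rewrite mxE.
apply: smooth_at_sum => i _; apply: smooth_at_sum => j _; apply: smooth_atM.
  exists U; split=> //; apply: smooth_on_invmx => // [q Uq|k l].
    exact: gram_unitmx Uq.
  exact: smooth_gram.
by exists U; split=> //; apply: smooth_curvature4.
Qed.

Lemma smooth_einstein : smooth_on U einstein_alpha /\ smooth_on U einstein_beta.
Proof.
have sG i j p : U p -> smooth_at p (fun q => gram g f q i j).
  by move=> Up; exists U; split=> //; apply: smooth_gram.
have sr i j p : U p -> smooth_at p (fun q => ricci_mx q i j).
  by move=> Up; exists U; split=> //; apply: smooth_ricci_mx.
have sd p : U p ->
    smooth_at p (fun q => (gram g f q 0 0 ^+ 2 - 2 * gram g f q 0 1 ^+ 2)^-1).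
  move=> Up; exists U; split=> //; apply: smooth_onV => // [q Uq|].
    exact: skew_discriminant_neq0.
  apply/smooth_onP => // q Uq; apply: smooth_atB.
    by apply: smooth_atM; apply: sG.
  apply: smooth_atM; first exact: smooth_at_cst.
  by apply: smooth_atM; apply: sG.
split; apply/smooth_onP => // p Up; (apply: smooth_atM; last exact: sd);
  apply: smooth_atB; apply: smooth_atM; try exact: sG; try exact: sr.
by apply: smooth_atM; [apply: smooth_at_cst|apply: sr].
Qed.

End SkewFrame.

(** * Gluing the local coefficients *)

Section AlmostEinstein.
Variables (R : realType) (M : manifold R 4) (g : riemannian_metric M)
  (S : skew_circulant_structure g) (D : section M -> section M -> section M).
Hypotheses (LC : levi_civita g D) (S_inv : S_invariant_curvature S D).

(** All frames and fields defined near [p] are quantified over, so that the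
    coefficients [a] and [b] depend on nothing but [p]. *)
Definition einstein_at (p : M) (a b : R) : Prop :=
  forall (U : set M) (e : 'I_4 -> section M) (X Y : section M),
    open U -> local_frame U e -> smooth_field U X -> smooth_field U Y -> U p ->
    ricci g D e X Y p = a * g p (X p) (Y p) + b * associated_metric S (X p) (Y p).

Lemma einstein_local (p : M) : exists U (alpha beta : M -> R),
  [/\ open U, U p, smooth_on U alpha, smooth_on U beta
    & forall q, U q -> einstein_at q (alpha q) (beta q)].
Proof.
have [U [f [oU Up fr Sf pos]]] := S_frame S p.
have [sa sb] := smooth_einstein LC oU fr pos.
exists U, (einstein_alpha g D f), (einstein_beta g D f); split=> // q Uq.
move=> V e X Y oV fre sX sY Vq.
have oUV := openI oU oV; have UVq : (U `&` V) q by [].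
have sub_U Z : smooth_field U Z -> smooth_field (U `&` V) Z.
  by apply: smooth_field_sub => ? [].
have sub_V Z : smooth_field V Z -> smooth_field (U `&` V) Z.
  by apply: smooth_field_sub => ? [].
have sf i := sub_U _ (fr.1 i); have se i := sub_V _ (fre.1 i).
have {}sX := sub_V _ sX; have {}sY := sub_V _ sY.
have [E eE] := frame_transition e fr Uq.
rewrite (ricci_frame LC oUV UVq se sf sX sY (gram_unitmx g fre Vq) eE).
have [x Xx] := frame_coord (X q) fr Uq; have [y Yy] := frame_coord (Y q) fr Uq.
have -> : ricci g D f X Y q = (x *m ricci_mx g D f q *m y^T) 0 0.
  rewrite mulmx_bilinE (ricci_combl LC oUV UVq sf sf sX sY Xx).
  apply: eq_bigr => i _; rewrite (ricci_combr LC oUV UVq sf sf (sf i) sY Yy).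
  by congr (_ * _); apply: eq_bigr => j _; rewrite mxE.
rewrite (metric_coord g Xx Yy) (associated_metric_coord Sf Uq Xx Yy).
rewrite [ricci_mx g D f q](skew_invariant_decomposition (G := gram g f q)).
- rewrite -/(einstein_alpha g D f q) -/(einstein_beta g D f q).
  move: (gram g f q *m _ + _) => H.
  move: (einstein_alpha g D f q) (einstein_beta g D f q) => a b.
  rewrite mulmxDr mulmxDl -!scalemxAr -!scalemxAl mxE.
  by congr (_ + _); rewrite mxE.
- exact: (ricci_mx_sym LC oU fr Uq).
- exact: (ricci_mx_S_inv LC S_inv oU fr Sf Uq).
- exact: gram_sym.
- exact: (gram_S_inv Sf Uq).
- exact: (skew_discriminant_neq0 pos Uq).
Qed.

(** On the pairs [(f_0, f_0)] and [(f_0, f_1)] the metric and the associated metric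
    take the values [(A, 2 B)] and [(B, A)], whose determinant is nonzero. *)
Lemma einstein_uniq p a b a' b' :
  einstein_at p a b -> einstein_at p a' b' -> a = a' /\ b = b'.
Proof.
move=> ab ab'; have [U [f [oU Up fr Sf pos]]] := S_frame S p.
have eqn i j : a * gram g f p i j + b * associated_metric S (f i p) (f j p)
    = a' * gram g f p i j + b' * associated_metric S (f i p) (f j p).
  rewrite mxE -(ab U f (f i) (f j) oU fr (fr.1 i) (fr.1 j) Up).
  exact: ab' oU fr (fr.1 i) (fr.1 j) Up.
have := (eqn 0 0, eqn 0 1).
have e_coord (i : 'I_4) : f i p = \sum_j (delta_mx 0 i : 'rV[R]_4) 0 j *: f j p.
  rewrite (bigD1 i) //= mxE !eqxx scale1r big1 ?addr0 // => j ji.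
  by rewrite mxE (negPf ji) andbF scale0r.
rewrite !(associated_metric_coord Sf Up (e_coord _) (e_coord _)).
rewrite associated_matrixE; [|exact: gram_sym|exact: (gram_S_inv Sf Up)].
rewrite !trmx_delta -!rowE -!colE.
have := skew_discriminant_neq0 pos Up.
move: (gram g f p 0 0) (gram g f p 0 1) => A B AB; rewrite !mxE /= => -[eq1 eq2].
have e1 : (a - a') * A + (b - b') * (2 * B) = 0 by lra.
have e2 : (a - a') * B + (b - b') * A = 0 by lra.
have a_eq : (a - a') * (A ^+ 2 - 2 * B ^+ 2) = 0.
  by rewrite -(mulr0 A) -[in RHS]e1 -[RHS]subr0 -(mulr0 (2 * B)) -[in RHS]e2; ring.
have b_eq : (b - b') * (A ^+ 2 - 2 * B ^+ 2) = 0.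
  by rewrite -(mulr0 A) -[in RHS]e2 -[RHS]subr0 -(mulr0 B) -[in RHS]e1; ring.
move/eqP: a_eq; move/eqP: b_eq; rewrite !mulf_eq0 (negPf AB) !orbF !subr_eq0.
by move=> /eqP -> /eqP ->.
Qed.

End AlmostEinstein.

Theorem theorem3p3 (R : realType) (M : manifold R 4) (g : riemannian_metric M)
    (S : skew_circulant_structure g)
    (D : section M -> section M -> section M) :
  levi_civita g D -> S_invariant_curvature S D -> almost_einstein S D.
Proof.
move=> LC S_inv.
have /choice[ab abP] : forall p, exists ab : R * R, einstein_at S D p ab.1 ab.2.
  move=> p; have [U [alpha [beta [_ Up _ _ einU]]]] := einstein_local LC S_inv p.
  by exists (alpha p, beta p); apply: einU.
exists (fun p => (ab p).1), (fun p => (ab p).2).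
split=> [||U e X Y oU fr sX sY p Up]; last exact: abP oU fr sX sY Up.
- apply/smooth_onP => [|p _]; first exact: openT.
  have [U [alpha [beta [oU Up sa sb einU]]]] := einstein_local LC S_inv p.
  apply: (@smooth_at_eq _ _ _ _ alpha); last by exists U.
  apply: filterS (open_nbhs_nbhs (conj oU Up)) => q Uq.
  by have [] := einstein_uniq (einU q Uq) (abP q).
- apply/smooth_onP => [|p _]; first exact: openT.
  have [U [alpha [beta [oU Up sa sb einU]]]] := einstein_local LC S_inv p.
  apply: (@smooth_at_eq _ _ _ _ beta); last by exists U.
  apply: filterS (open_nbhs_nbhs (conj oU Up)) => q Uq.
  by have [] := einstein_uniq (einU q Uq) (abP q).
Qed.
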